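(* Let $d>1$, $p\in[1,\infty)$, and let $K$ be a proper convex cone in $\mathbb R^d$. Let $j:\mathcal F_{\mathrm{cconv}}(\mathbb R^d)\to L^p\left((0,1]\times\mathbb S^{d-1}\right)$, $j(x^* )=s_{x^*}(\cdot,\cdot)$, be the support function embedding, let $\mathcal H=j\left(\mathcal F_{\mathrm{cconv}}(\mathbb R^d)\right)$ and let $\mathcal K=j\left(\mathcal F^K_{\mathrm{cconv}}(\mathbb R^d)\right)$, where $\mathcal F^K_{\mathrm{cconv}}(\mathbb R^d)=\{x^*\in\mathcal F_{\mathrm{cconv}}(\mathbb R^d):\operatorname{supp}\xi_{x^*}\subset K\}$. Then $\mathcal K\subset\mathcal H$ and $\mathcal K$ is a proper convex cone in the Banach space $L^p((0,1]\times\mathbb S^{d-1})$.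
   Context: Fuzzy vectors. A $d$-dimensional fuzzy vector $x^*$ is identified with its characterizing function $\xi_{x^*}:\mathbb R^d\to[0,1]$, which is required to satisfy: (1) $\operatorname{supp}\xi_{x^*}:=\overline{\{x\in\mathbb R^d:\xi_{x^*}(x)>0\}}$ is bounded; (2) for every $\alpha\in(0,1]$ the $\alpha$-cut $C_\alpha(x^* )=\{x\in\mathbb R^d:\xi_{x^*}(x)\ge\alpha\}$ is non-empty, compact and convex, and so is $C_0(x^* ):=\operatorname{supp}\xi_{x^*}$. The set of all such fuzzy vectors is $\mathcal F_{\mathrm{cconv}}(\mathbb R^d)$. Support function. $\mathbb S^{d-1}$ is the Euclidean unit sphere of $\mathbb R^d$ and $\langle\cdot,\cdot\rangle$ the standard inner product. For $x^*\in\mathcal F_{\mathrm{cconv}}(\mathbb R^d)$, $s_{x^*}(\alpha,u)=\sup_{a\in C_\alpha(x^* )}\langle u,a\rangle$ for $\alpha\in(0,1]$, $u\in\mathbb S^{d-1}$. Banach space. $L^p((0,1]\times\mathbb S^{d-1})$ is the real $L^p$ space with respect to the product of Lebesgue measure on $(0,1]$ and normalized Lebesgue (surface) measure on $\mathbb S^{d-1}$. Cones. A subset of a real vector space is a convex cone if it is closed under addition and under multiplication by scalars $\lambda>0$. A convex cone $\mathcal C$ is called proper if $x\in\mathcal C$ and $-x\in\mathcal C$ imply $x=0$. *)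

(* Defs.v *)
From HB Require Import structures.
From mathcomp Require Import all_boot all_order all_algebra.
From mathcomp Require Import all_classical all_reals all_analysis.
From mathcomp Require Import measurable_realfun ess_sup_inf.
Set Implicit Arguments.
Unset Strict Implicit.
Unset Printing Implicit Defensive.
Import Order.TTheory GRing.Theory Num.Def Num.Theory.
Import numFieldNormedType.Exports.
Local Open Scope classical_set_scope.
Local Open Scope ring_scope.

Section cones.
Variables (R : numDomainType) (V : lmodType R).

Definition convex_cone (C : set V) : Prop :=
  (forall x y, C x -> C y -> C (x + y)) /\
  (forall (l : R) x, 0 < l -> C x -> C (l *: x)).

Definition proper_convex_cone (C : set V) : Prop :=
  convex_cone C /\ (forall x, C x -> C (- x) -> x = 0).

End cones.

(* [LspaceType mu p1] is the library's L^p space: classes of measurable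
   functions modulo mu-a.e. equality, with finite p-norm; it comes without
   algebraic structure. Here it becomes a real vector space, with the operations
   computed on representatives ([Lspace0E], [LspaceDE], [LspaceZE]). *)
Section Lspace_lmodType.
Context d (T : measurableType d) (R : realType).
Variables (mu : {measure set T -> \bar R}) (p : \bar R) (p1 : (1 <= p)%E).
Local Notation Lp := (LspaceType mu p1).
Local Notation Lfun := (@Lfun _ T R mu p).

Lemma ae_eq_finite_norm (f g : T -> R) :
  measurable_fun setT f -> measurable_fun setT g ->
  f = g %[ae mu] -> finite_norm mu p f -> finite_norm mu p g.
Proof.
move=> mf mg fg; rewrite /finite_norm.
suff -> : ('N[mu]_p[EFin \o f] = 'N[mu]_p[EFin \o g])%E by [].
rewrite unlock; move: p p1 => [r r1|_|//].
- congr (_ `^ _)%E; apply: ge0_ae_eq_integral => //=.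
  + have -> : (fun x => `|(f x)%:E| `^ r)%E = EFin \o ((@powR R ^~ r) \o (normr \o f)).
      by apply/funext.
    apply/measurable_EFinP; apply: measurableT_comp => //.
    exact: measurableT_comp.
  + have -> : (fun x => `|(g x)%:E| `^ r)%E = EFin \o ((@powR R ^~ r) \o (normr \o g)).
      by apply/funext.
    apply/measurable_EFinP; apply: measurableT_comp => //.
    exact: measurableT_comp.
  + by apply: (filterS _ fg) => x fgx _ /=; rewrite (fgx Logic.I).
- case: ifPn => // _; apply: eq_ess_sup.
  by apply: (filterS _ fg) => x fgx /=; rewrite (fgx Logic.I).
Qed.

Lemma Lspace_in_Lfun (f : Lp) : (f : T -> R) \in Lfun.
Proof.
rewrite inE; apply/andP; split; rewrite inE /=.
  exact: (@measurable_funPT _ _ _ _ (repr (f : {mfun_ mu, T >-> measurableTypeR R}))).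
by case: f => f [[]].
Qed.

Section Lclass.
Variables (f : T -> R) (fL : f \in Lfun).

Let f0 : {mfun T >-> measurableTypeR R} := @mfun_Sub _ _ T (measurableTypeR R) f (sub_Lfun_mfun fL).
Let q : {mfun_ mu, T >-> measurableTypeR R} := \pi_({mfun_ mu, T >-> measurableTypeR R})%qT f0.

Let q_ae : (q : T -> R) = f %[ae mu].
Proof.
have /eqmodP/asboolP : (repr q = f0 %[mod {mfun_ mu, T >-> measurableTypeR R}])%qT by rewrite reprK.
by [].
Qed.

Let q_finite : finite_norm mu p q.
Proof.
have mf : measurable_fun setT f by have /set_mem := sub_Lfun_mfun fL.
apply: (@ae_eq_finite_norm f) => //.
- exact: (@measurable_funPT _ _ _ _ (repr q)).
- exact: ae_eq_sym.
- by have /set_mem := sub_Lfun_finLfun fL.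
Qed.

Definition Lclass : Lp := HB.pack_for Lp q (isFinLebesgue.Build _ T R mu p p1 q q_finite).

Lemma LclassE : (Lclass : T -> R) = f %[ae mu].
Proof. exact: q_ae. Qed.

End Lclass.

Lemma Lspace_eqP (f g : Lp) : f = g <-> (f : T -> R) = g %[ae mu].
Proof.
split=> [->|fg]; first exact: ae_eq_refl.
have : (f : {mfun_ mu, T >-> measurableTypeR R}) = g.
  rewrite -[LHS]reprK -[RHS]reprK; apply/eqmodP/asboolP; exact: fg.
case: f g {fg} => [f [[hf]]] [g [[hg]]] /= fg; subst g.
by rewrite (Prop_irrelevance hf hg).
Qed.

HB.instance Definition _ := gen_eqMixin Lp.
HB.instance Definition _ := gen_choiceMixin Lp.

Let in0 : (0 : T -> R) \in Lfun.
Proof. by case: (Lfun_addr_closed mu p1). Qed.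

Let inD (f g : T -> R) : f \in Lfun -> g \in Lfun -> f + g \in Lfun.
Proof. by case: (Lfun_addr_closed mu p1) => _; apply. Qed.

Let inN (f : T -> R) : f \in Lfun -> - f \in Lfun.
Proof. exact: (Lfun_oppr_closed (mu := mu) (p := p)). Qed.

Let inZ (a : R) (f : T -> R) : f \in Lfun -> a *: f \in Lfun.
Proof.
move=> fL; have [_ /(_ a f 0 fL in0)] := Lfun_submod_closed mu p1.
by rewrite addr0.
Qed.

Let Lzero : Lp := Lclass in0.
Let Lopp (f : Lp) : Lp := Lclass (inN (Lspace_in_Lfun f)).
Let Ladd (f g : Lp) : Lp := Lclass (inD (Lspace_in_Lfun f) (Lspace_in_Lfun g)).
Let Lscale (a : R) (f : Lp) : Lp := Lclass (inZ a (Lspace_in_Lfun f)).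

Let LclassE' (f : T -> R) (fL : f \in Lfun) :
  \forall x \ae mu, (Lclass fL : T -> R) x = f x.
Proof. by apply: (filterS _ (LclassE fL)) => x; apply. Qed.

Let Lspace_eq (f g : Lp) : (\forall x \ae mu, (f : T -> R) x = g x) -> f = g.
Proof. by move=> fg; apply/Lspace_eqP; apply: (filterS _ fg). Qed.

Let LzeroE : \forall x \ae mu, (Lzero : T -> R) x = 0.
Proof. exact: LclassE'. Qed.

Let LoppE f : \forall x \ae mu, (Lopp f : T -> R) x = - f x.
Proof. exact: LclassE'. Qed.

Let LaddE f g : \forall x \ae mu, (Ladd f g : T -> R) x = f x + g x.
Proof. exact: LclassE'. Qed.

Let LscaleE a f : \forall x \ae mu, (Lscale a f : T -> R) x = a * f x.
Proof. exact: LclassE'. Qed.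

Let LaddA : associative Ladd.
Proof.
move=> f g h; apply: Lspace_eq.
apply: (filterS2 _ _ (filterI (LaddE f (Ladd g h)) (LaddE g h))
                   (filterI (LaddE (Ladd f g) h) (LaddE f g))).
by move=> x [-> ->] [-> ->]; rewrite addrA.
Qed.

Let LaddC : commutative Ladd.
Proof.
move=> f g; apply: Lspace_eq; apply: (filterS2 _ _ (LaddE f g) (LaddE g f)).
by move=> x -> ->; rewrite addrC.
Qed.

Let Ladd0 : left_id Lzero Ladd.
Proof.
move=> f; apply: Lspace_eq; apply: (filterS2 _ _ (LaddE Lzero f) LzeroE).
by move=> x -> ->; rewrite add0r.
Qed.

Let LaddN : left_inverse Lzero Lopp Ladd.
Proof.
move=> f; apply: Lspace_eq.
apply: (filterS3 _ _ (LaddE (Lopp f) f) (LoppE f) LzeroE).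
by move=> x -> -> ->; rewrite addNr.
Qed.

HB.instance Definition _ := GRing.isZmodule.Build Lp LaddA LaddC Ladd0 LaddN.

Let LscaleA a b f : Lscale a (Lscale b f) = Lscale (a * b) f.
Proof.
apply: Lspace_eq.
apply: (filterS3 _ _ (LscaleE a (Lscale b f)) (LscaleE b f) (LscaleE (a * b) f)).
by move=> x -> -> ->; rewrite mulrA.
Qed.

Let Lscale1 : left_id 1 Lscale.
Proof.
move=> f; apply: Lspace_eq; apply: (filterS _ (LscaleE 1 f)).
by move=> x ->; rewrite mul1r.
Qed.

Let LscaleDr : right_distributive Lscale +%R.
Proof.
move=> a f g; apply: Lspace_eq.
apply: (filterS3 _ _ (filterI (LscaleE a (f + g)) (LaddE f g))
  (LaddE (Lscale a f) (Lscale a g)) (filterI (LscaleE a f) (LscaleE a g))).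
by move=> x [-> ->] -> [-> ->]; rewrite mulrDr.
Qed.

Let LscaleDl f : {morph Lscale^~ f : a b / a + b}.
Proof.
move=> a b; apply: Lspace_eq.
apply: (filterS3 _ _ (LscaleE (a + b) f) (LaddE (Lscale a f) (Lscale b f))
  (filterI (LscaleE a f) (LscaleE b f))).
by move=> x -> -> [-> ->]; rewrite mulrDl.
Qed.

HB.instance Definition _ :=
  GRing.Zmodule_isLmodule.Build R Lp LscaleA Lscale1 LscaleDr LscaleDl.

Lemma Lspace0E : ((0 : Lp) : T -> R) = (fun=> 0) %[ae mu].
Proof. exact: LclassE. Qed.

Lemma LspaceDE (f g : Lp) : ((f + g : Lp) : T -> R) = (fun x => f x + g x) %[ae mu].
Proof. exact: LclassE. Qed.

Lemma LspaceZE (a : R) (f : Lp) : ((a *: f : Lp) : T -> R) = (fun x => a * f x) %[ae mu].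
Proof. exact: LclassE. Qed.

End Lspace_lmodType.

Definition rV_display : measure_display. Proof. exact. Qed.

(* The sigma-algebra generated by the coordinates, i.e. the Borel sets of R^n. *)
Section rV_measurable.
Variables (R : realType) (n : nat).

Let coord (i : 'I_n) (v : 'rV[R]_n) : measurableTypeR R := v ord0 i.

HB.instance Definition _ := @isMeasurable.Build rV_display 'rV[R]_n
  (g_sigma_preimage coord) (@sigma_algebra0 _ _ _) (@sigma_algebraC _ _)
  (@sigma_algebra_bigcup _ _ _).

Lemma measurable_coord i : measurable_fun [set: 'rV[R]_n] (fun v => v ord0 i).
Proof.
move=> _ Y mY; rewrite setTI; apply: sub_sigma_algebra => /=.
rewrite -bigcup_seq/=; exists i => /=; first by rewrite mem_index_enum.
by exists Y => //; rewrite setTI.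
Qed.

Lemma measurable_fun_rV d (T : measurableType d) (f : T -> 'rV[R]_n) :
  (forall i, measurable_fun [set: T] (fun x => f x ord0 i)) ->
  measurable_fun [set: T] f.
Proof.
move=> mf _ A mA; rewrite setTI.
pose C := image_set_system setT f (@measurable _ T).
suff : g_sigma_preimage coord `<=` C by move=> /(_ _ mA); rewrite /C /image_set_system/= setTI.
apply: smallest_sub.
  exact/sigma_algebra_image/sigma_algebra_measurable.
rewrite -bigcup_seq; apply: bigcup_sub => i _ _ [B mB <-].
by rewrite /C /image_set_system /= setTI; exact: mf.
Qed.

End rV_measurable.

Lemma product_sigma_finite d1 d2 (T1 : measurableType d1)
    (T2 : measurableType d2) (R : realType)
    (m1 : {sigma_finite_measure set T1 -> \bar R})
    (m2 : {sigma_finite_measure set T2 -> \bar R}) :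
  sigma_finite setT (m1 \x m2)%E.
Proof.
have /sigma_finiteP[F [TF ndF Foo]] := sigma_finiteT m1.
have /sigma_finiteP[G [TG ndG Goo]] := sigma_finiteT m2.
exists (fun n => F n `*` G n).
  rewrite -setXTT TF TG predeqE => -[x y]; split.
    move=> [/= [n _ Fnx] [k _ Gky]]; exists (maxn n k) => //; split.
    - by move: x Fnx; exact/subsetPset/ndF/leq_maxl.
    - by move: y Gky; exact/subsetPset/ndG/leq_maxr.
  by move=> [n _ []/= ? ?]; split; exists n.
move=> k; have [? ?] := Foo k; have [? ?] := Goo k.
split; first exact: measurableX.
by rewrite product_measure1E// lte_mul_pinfty// ge0_fin_numE.
Qed.

Section rV_cons.
Variables (R : realType) (n : nat).

Definition rV_cons (z : R * 'rV[R]_n) : 'rV[R]_n.+1 := row_mx z.1%:M z.2.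
Definition rV_uncons (v : 'rV[R]_n.+1) : R * 'rV[R]_n :=
  (lsubmx (v : 'rV_(1 + n)) ord0 ord0, rsubmx (v : 'rV_(1 + n))).

Lemma rV_consK : cancel rV_cons rV_uncons.
Proof.
move=> [a v]; rewrite /rV_uncons /rV_cons row_mxKl row_mxKr /=.
by rewrite mxE mulr1n.
Qed.

Lemma measurable_rV_cons : measurable_fun setT rV_cons.
Proof.
apply: measurable_fun_rV => i.
rewrite /rV_cons; case: (splitP (i : 'I_(1 + n))) => j ij.
  have -> : i = lshift n j by apply: val_inj.
  have -> : (fun x : R * 'rV[R]_n => (row_mx x.1%:M x.2 : 'rV_(1 + n)) ord0 (lshift n j)) = fst.
    by apply/funext => x; rewrite row_mxEl (ord1 j) mxE mulr1n.
  exact: measurable_fst.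
have -> : i = rshift 1 j by apply: val_inj.
have -> : (fun x : R * 'rV[R]_n => (row_mx x.1%:M x.2 : 'rV_(1 + n)) ord0 (rshift 1 j)) = (fun v : 'rV[R]_n => v ord0 j) \o snd.
  by apply/funext => x; rewrite row_mxEr.
by apply: measurableT_comp => //; exact: measurable_coord.
Qed.

Lemma measurable_rV_uncons : measurable_fun setT rV_uncons.
Proof.
apply: measurable_fun_pair.
  rewrite [X in measurable_fun _ X](_ : _ = (fun v : 'rV[R]_n.+1 => v ord0 (lshift n ord0 : 'I_(1 + n)))); last first.
    by apply/funext => v; rewrite mxE.
  exact: measurable_coord.
apply: measurable_fun_rV => i.
rewrite [X in measurable_fun _ X](_ : _ = (fun v : 'rV[R]_n.+1 => v ord0 (rshift 1 i))); last first.
  by apply/funext => v; rewrite mxE.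
exact: measurable_coord.
Qed.

Variable m : {sigma_finite_measure set 'rV[R]_n -> \bar R}.

Definition rV_step : set 'rV[R]_n.+1 -> \bar R :=
  pushforward (lebesgue_measure \x m)%E rV_cons.

Let step0 : rV_step set0 = 0%E.
Proof. by rewrite /rV_step /pushforward preimage_set0 measure0. Qed.

Let step_ge0 A : (0 <= rV_step A)%E.
Proof. by rewrite /rV_step /pushforward; exact: measure_ge0. Qed.

Let step_sigma_additive : semi_sigma_additive rV_step.
Proof.
move=> F mF tF mUF; rewrite /rV_step /pushforward preimage_bigcup.
apply: measure_semi_sigma_additive.
- by move=> k; rewrite -[X in measurable X]setTI; exact: measurable_rV_cons.
- apply/trivIsetP => /= i j _ _ ij; rewrite -preimage_setI.
  by move/trivIsetP : tF => /(_ _ _ _ _ ij) ->//; rewrite preimage_set0.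
- rewrite -preimage_bigcup -[X in measurable X]setTI.
  exact: measurable_rV_cons.
Qed.

HB.instance Definition _ := isMeasure.Build _ _ _ rV_step
  step0 step_ge0 step_sigma_additive.

Let step_sigma_finite : sigma_finite setT rV_step.
Proof.
have [F UF mF] := product_sigma_finite (@lebesgue_measure R) m.
exists (fun k => rV_uncons @^-1` F k).
  by rewrite -preimage_bigcup -UF preimage_setT.
move=> k; have [mFk Fk] := mF k; split.
  by rewrite -[X in measurable X]setTI; exact: measurable_rV_uncons.
rewrite /rV_step /pushforward -comp_preimage.
by rewrite (_ : _ \o _ = id) ?preimage_id//; apply/funext => z /=; rewrite rV_consK.
Qed.

HB.instance Definition _ := @Measure_isSigmaFinite.Build _ _ _ rV_step
  step_sigma_finite.

End rV_cons.

(* n-dimensional Lebesgue (Borel) measure, as an iterated product along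
   R^(k+1) = R x R^k; see [rV_lebesgue_box]. *)
Fixpoint rV_lebesgue (R : realType) (n : nat) :
    {sigma_finite_measure set 'rV[R]_n -> \bar R} :=
  if n is k.+1 then rV_step (rV_lebesgue R k) else \d_(0 : 'rV[R]_0).

Lemma measurable_rV_box (R : realType) n (a b : R) :
  measurable [set v : 'rV[R]_n | forall i, a < v ord0 i < b].
Proof.
have -> : [set v : 'rV[R]_n | forall i, a < v ord0 i < b] =
    \bigcap_(i in [set: 'I_n]) ((fun v : 'rV[R]_n => v ord0 i) @^-1` `]a, b[).
  apply/seteqP; split => v /= vab i; first by move=> _; rewrite /= in_itv/=.
  by have := vab i Logic.I; rewrite /= in_itv/=.
apply: fin_bigcap_measurable => // i _; rewrite -[X in measurable X]setTI.
by apply: measurable_coord => //; exact: measurable_itv.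
Qed.

Lemma rV_cons_head (R : realType) n (z : R * 'rV[R]_n) (i : 'I_1) :
  rV_cons z ord0 (lshift n i) = z.1.
Proof. by rewrite [LHS](@row_mxEl R 1 1 n z.1%:M z.2) ord1 (ord1 i) mxE mulr1n. Qed.

Lemma rV_cons_tail (R : realType) n (z : R * 'rV[R]_n) (i : 'I_n) :
  rV_cons z ord0 (rshift 1 i) = z.2 ord0 i.
Proof. exact: (@row_mxEr R 1 1 n z.1%:M z.2). Qed.

Lemma rV_lebesgue_box (R : realType) n (a b : R) : a < b ->
  rV_lebesgue R n [set v | forall i, a < v ord0 i < b] = ((b - a) ^+ n)%:E.
Proof.
move=> ab; elim: n => [|n IHn].
  by rewrite /= /dirac indicE mem_set// => -[].
pose B := [set v : 'rV[R]_n | forall i, a < v ord0 i < b].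
transitivity (@lebesgue_measure R `]a, b[ * rV_lebesgue R n B)%E; last first.
  by rewrite IHn lebesgue_measure_itv /= lte_fin ab -EFinB -EFinM exprS.
rewrite -product_measure1E//; last exact: measurable_rV_box.
rewrite /= /rV_step /pushforward; congr (_ _).
apply/seteqP; split => -[t v] /=.
  move=> vab; split.
    have := vab (lshift n ord0 : 'I_(1 + n)).
    by rewrite rV_cons_head /= in_itv.
  by move=> i; have := vab (rshift 1 i); rewrite rV_cons_tail.
rewrite in_itv /= => -[tab vab] i.
case: (splitP (i : 'I_(1 + n))) => j ij.
  have -> : i = lshift n j by apply: val_inj.
  by rewrite rV_cons_head.
have -> : i = rshift 1 j by apply: val_inj.
by rewrite rV_cons_tail.
Qed.

Section euclidean.
Variables (R : realType) (d : nat).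
Implicit Types u v : 'rV[R]_d.

Definition dotp u v : R := \sum_i u ord0 i * v ord0 i.

Definition enorm u : R := Num.sqrt (dotp u u).

Lemma enorm_ge0 u : 0 <= enorm u.
Proof. exact: sqrtr_ge0. Qed.

Lemma measurable_enorm : measurable_fun setT enorm.
Proof.
rewrite /enorm /dotp.
apply: (@measurableT_comp _ _ _ _ _ _ (@Num.sqrt R)).
  apply: continuous_measurable_fun; exact: sqrt_continuous.
apply: measurable_sum => i; apply: measurable_funM; exact: measurable_coord.
Qed.

Lemma measurable_dir : measurable_fun setT (fun u => (enorm u)^-1 *: u).
Proof.
apply: measurable_fun_rV => i.
rewrite [X in measurable_fun _ X](_ : _ =
  (fun u => (@powR R ^~ (-1)) (enorm u) * u ord0 i)); last first.
  by apply/funext => u; rewrite mxE powR_inv1// enorm_ge0.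
apply: measurable_funM; last exact: measurable_coord.
by apply: (@measurableT_comp _ _ _ _ _ _ (@powR R ^~ (-1))) => //; exact: measurable_enorm.
Qed.

Lemma dotpZ a b u : dotp (a *: u) (b *: u) = a * b * dotp u u.
Proof.
by rewrite /dotp mulr_sumr; apply: eq_bigr => i _; rewrite !mxE mulrACA.
Qed.

Lemma enormZ a u : 0 <= a -> enorm (a *: u) = a * enorm u.
Proof.
move=> a0; rewrite /enorm dotpZ sqrtrM ?mulr_ge0//.
by rewrite -expr2 sqrtr_sqr ger0_norm.
Qed.

Lemma normr_coord_le_enorm u i : `|u ord0 i| <= enorm u.
Proof.
rewrite -sqrtr_sqr ler_wsqrtr// /dotp (bigD1 i)//= -expr2 lerDl.
by apply: sumr_ge0 => j _; rewrite -expr2 sqr_ge0.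
Qed.

End euclidean.

(* The (unused) proof of 1 < d makes the sphere nonempty, which the library
   requires of measurable types. *)
Definition sphere (R : realType) (d : nat) of (1 < d)%N : Type :=
  {u : 'rV[R]_d | enorm u == 1}.
Arguments sphere R {d} d1.

Section sphere.
Variables (R : realType) (d : nat) (d1 : (1 < d)%N).
Local Notation S := (sphere R d1).

Definition sphere_val (u : S) : 'rV[R]_d := \val u.

HB.instance Definition _ := Choice.copy S {u : 'rV[R]_d | enorm u == 1}.

Let e0 : 'rV[R]_d := delta_mx ord0 (Ordinal (ltn_trans (ltn0Sn 0) d1)).

Let e0_sphere : enorm e0 == 1.
Proof.
rewrite /enorm /dotp (bigD1 (Ordinal (ltn_trans (ltn0Sn 0) d1)))//= big1 => [|i i0].
  by rewrite !mxE !eqxx /= mulr1 addr0 sqrtr1.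
by rewrite !mxE (negbTE i0) andbF mul0r.
Qed.

HB.instance Definition _ := isPointed.Build S (exist _ e0 e0_sphere).

HB.instance Definition _ :=
  Measurable.copy S (g_sigma_algebra_preimageType sphere_val).

Lemma measurable_sphere_val : measurable_fun setT sphere_val.
Proof. by move=> _ B mB; exists B. Qed.

(* the part over A of the closed unit ball without its center *)
Definition sphere_cone (A : set S) : set 'rV[R]_d :=
  [set x | 0 < enorm x <= 1 /\
           exists2 u, A u & x = enorm x *: sphere_val u].

Lemma sphere_val_dir (u : S) r : 0 < r ->
  (enorm (r *: sphere_val u))^-1 *: (r *: sphere_val u) = sphere_val u.
Proof.
move=> r0; rewrite (enormZ _ (ltW r0)) (eqP (valP u)) mulr1 scalerA mulVf ?scale1r//.
by rewrite gt_eqF.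
Qed.

Lemma measurable_sphere_cone (A : set S) :
  measurable A -> measurable (sphere_cone A).
Proof.
move=> [B mB <-].
have -> : sphere_cone (setT `&` sphere_val @^-1` B) =
    enorm (d:=d) @^-1` `]0, 1] `&` (fun x => (enorm x)^-1 *: x) @^-1` B.
  apply/seteqP; split => x /=.
    move=> [x01 [u [_ Bu] xu]]; split; first by rewrite in_itv.
    by rewrite xu sphere_val_dir //; case/andP: x01.
  rewrite in_itv /= => -[x01 Bx]; split => //.
  have x0 : enorm x != 0 by case/andP: x01 => x0 _; rewrite gt_eqF.
  have vx : enorm ((enorm x)^-1 *: x) == 1.
    by rewrite enormZ ?invr_ge0 ?enorm_ge0// mulVf.
  exists (exist _ ((enorm x)^-1 *: x) vx : S) => //.
  by rewrite /sphere_val /= scalerA mulfV// scale1r.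
apply: measurableI; rewrite -[X in measurable X]setTI.
- by apply: measurable_enorm => //; exact: measurable_itv.
- exact: measurable_dir.
Qed.

(* Up to normalization, the surface measure of A is the Lebesgue measure of the
   cone spanned by A in the unit ball. *)
Definition sphere_content (A : set S) : \bar R :=
  rV_lebesgue R d (sphere_cone A).

Let content0 : sphere_content set0 = 0%E.
Proof.
rewrite /sphere_content (_ : sphere_cone set0 = set0) ?measure0//.
by apply/seteqP; split => // x [_ []].
Qed.

Let content_ge0 A : (0 <= sphere_content A)%E.
Proof. exact: measure_ge0. Qed.

Let content_sigma_additive : semi_sigma_additive sphere_content.
Proof.
move=> F mF tF mUF.
have UE : sphere_cone (\bigcup_n F n) = \bigcup_n sphere_cone (F n).
  apply/seteqP; split => x /=.
    by move=> [x01 [u [n _ Fu] xu]]; exists n => //; split => //; exists u.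
  by move=> [n _ [x01 [u Fu xu]]]; split => //; exists u => //; exists n.
rewrite /sphere_content UE; apply: measure_semi_sigma_additive.
- by move=> n; exact: measurable_sphere_cone.
- apply/trivIsetP => i j _ _ ij; rewrite -subset0 => x [].
  move=> [/andP[x0 _] [u Fu xu]] [_ [v Fv xv]].
  move/trivIsetP : tF => /(_ _ _ Logic.I Logic.I ij); rewrite -subset0; apply.
  suff uv : u = v by split; [exact: Fu|rewrite uv].
  apply: val_inj.
  by rewrite -[LHS](sphere_val_dir u x0) -[RHS](sphere_val_dir v x0) -xu -xv.
- by rewrite -UE; exact: measurable_sphere_cone.
Qed.

HB.instance Definition _ := isMeasure.Build _ _ _ sphere_content
  content0 content_ge0 content_sigma_additive.

End sphere.

Lemma sphere_content_gt0_lty (R : realType) d (d1 : (1 < d)%N) :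
  (0 < sphere_content [set: sphere R d1] < +oo)%E.
Proof.
have d0 : (0 : R) < d%:R by rewrite ltr0n (ltn_trans _ d1).
have mC : measurable (sphere_cone [set: sphere R d1]).
  exact: measurable_sphere_cone.
apply/andP; split; last first.
  apply: (@le_lt_trans _ _ (rV_lebesgue R d [set v : 'rV[R]_d | forall i, -2 < v ord0 i < 2])).
    apply: le_measure; rewrite ?inE//; first exact: measurable_rV_box.
    move=> x [/andP[_ x1] _] i; rewrite -ltr_norml.
    by rewrite (le_lt_trans (le_trans (normr_coord_le_enorm x i) x1))// ltr1n.
  by rewrite rV_lebesgue_box ?ltry// gtrN.
apply: (@lt_le_trans _ _ (rV_lebesgue R d [set v : 'rV[R]_d | forall i, 0 < v ord0 i < d%:R^-1])).
  by rewrite rV_lebesgue_box ?invr_gt0// lte_fin exprn_gt0// subr0 invr_gt0.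
apply: le_measure; rewrite ?inE//; first exact: measurable_rV_box.
move=> x xd.
have x0 : 0 < enorm x.
  have i0 : 'I_d by exact: Ordinal (ltn_trans (ltn0Sn 0) d1).
  apply: lt_le_trans (normr_coord_le_enorm x i0).
  by rewrite normr_gt0; have /andP[/gt_eqF->] := xd i0.
have vx : enorm ((enorm x)^-1 *: x) == 1.
  by rewrite enormZ ?invr_ge0 ?enorm_ge0// mulVf// gt_eqF.
split.
  rewrite x0 /= -sqrtr1 ler_wsqrtr// (@le_trans _ _ (\sum_(i < d) d%:R^-1))//.
    apply: ler_sum => i _; have /andP[xi0 xi1] := xd i.
    rewrite -[leRHS]mulr1; apply: ler_pM => //; try exact: ltW.
    rewrite (le_trans (ltW xi1))// invf_le1// ler1n (ltn_trans _ d1)//.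
  by rewrite sumr_const card_ord -(mulr_natr d%:R^-1 d) mulVf// gt_eqF.
exists (exist _ ((enorm x)^-1 *: x) vx : sphere R d1) => //.
by rewrite /sphere_val /= scalerA mulfV ?scale1r// gt_eqF.
Qed.

(* By [sphere_content_gt0_lty], the default value of [mnormalize] is not used. *)
Definition sphere_measure (R : realType) d (d1 : (1 < d)%N) :
    probability (sphere R d1) R :=
  mnormalize (@sphere_content R d d1) \d_point.

Section unit_itv.
Variable R : realType.

Definition unit_itv : Type := {a : R | a \in `]0, 1]}.

Definition unit_itv_val (a : unit_itv) : measurableTypeR R := \val a.

HB.instance Definition _ := Choice.copy unit_itv {a : R | a \in `]0, 1]}.

Let one_itv : (1 : R) \in `]0, 1].
Proof. by rewrite in_itv /= ltr01 lexx. Qed.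

HB.instance Definition _ := isPointed.Build unit_itv (exist _ 1 one_itv).

HB.instance Definition _ :=
  Measurable.copy unit_itv (g_sigma_algebra_preimageType unit_itv_val).

Definition unit_itv_lebesgue (A : set unit_itv) : \bar R :=
  lebesgue_measure (unit_itv_val @` A).

Let imageE (B : set (measurableTypeR R)) :
  unit_itv_val @` (setT `&` unit_itv_val @^-1` B) = `]0, 1] `&` B.
Proof.
apply/seteqP; split => [_ [a [_ Ba] <-]|a /= [a01 Ba]].
  by split => //; exact: (valP a).
by exists (exist _ a a01 : unit_itv).
Qed.

Let measurable_image (A : set unit_itv) :
  measurable A -> measurable (unit_itv_val @` A).
Proof.
move=> [B mB <-]; rewrite imageE; exact: measurableI.
Qed.

Let lebesgue0 : unit_itv_lebesgue set0 = 0%E.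
Proof. by rewrite /unit_itv_lebesgue image_set0 measure0. Qed.

Let lebesgue_ge0 A : (0 <= unit_itv_lebesgue A)%E.
Proof. exact: measure_ge0. Qed.

Let lebesgue_sigma_additive : semi_sigma_additive unit_itv_lebesgue.
Proof.
move=> F mF tF mUF; rewrite /unit_itv_lebesgue image_bigcup.
apply: measure_semi_sigma_additive.
- by move=> n; exact: measurable_image.
- apply/trivIsetP => i j _ _ ij; rewrite -subset0 => _ [[a Fa <-] [b Fb ba]].
  move/trivIsetP : tF => /(_ _ _ Logic.I Logic.I ij); rewrite -subset0; apply.
  by split; [exact: Fa|rewrite -(val_inj ba)].
- by rewrite -image_bigcup; exact: measurable_image.
Qed.

HB.instance Definition _ := isMeasure.Build _ _ _ unit_itv_lebesgue
  lebesgue0 lebesgue_ge0 lebesgue_sigma_additive.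

Let lebesgueT : unit_itv_lebesgue setT = 1%E.
Proof.
rewrite /unit_itv_lebesgue -[setT]setIT -(preimage_setT unit_itv_val) imageE setIT.
by rewrite lebesgue_measure_itv/= lte_fin ltr01 oppr0 adde0.
Qed.

HB.instance Definition _ :=
  Measure_isProbability.Build _ _ _ unit_itv_lebesgue lebesgueT.

End unit_itv.

(* The topology of 'rV[R]_d is given by the sup norm; closure, boundedness and
   compactness are the Euclidean ones. *)
Definition fuzzy_supp (R : realType) d (xi : 'rV[R]_d -> R) : set 'rV[R]_d :=
  closure [set x | 0 < xi x].

Definition fuzzy_cut (R : realType) d (xi : 'rV[R]_d -> R) (a : R) :
    set 'rV[R]_d :=
  [set x | a <= xi x].

Record fuzzy_vector (R : realType) (d : nat) := FuzzyVector {
  fuzzy_char :> 'rV[R]_d -> R ;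
  fuzzy_char_itv : forall x, 0 <= fuzzy_char x <= 1 ;
  fuzzy_supp_bounded : bounded_set (fuzzy_supp fuzzy_char) ;
  fuzzy_cutP : forall a : R, 0 < a <= 1 ->
    [/\ fuzzy_cut fuzzy_char a !=set0, compact (fuzzy_cut fuzzy_char a)
      & convex_set (fuzzy_cut fuzzy_char a)] ;
  fuzzy_suppP : [/\ fuzzy_supp fuzzy_char !=set0,
    compact (fuzzy_supp fuzzy_char) & convex_set (fuzzy_supp fuzzy_char)]
}.

Section support_function.
Variables (R : realType) (d : nat) (d1 : (1 < d)%N).
Local Notation X := (unit_itv R * sphere R d1)%type.
Local Notation mu := (unit_itv_lebesgue (R := R) \x sphere_measure R d1)%E.

Definition support_fun (x : fuzzy_vector R d) (z : X) : R :=
  sup [set dotp (sphere_val z.2) a | a in fuzzy_cut x (unit_itv_val z.1)].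

Variable x : fuzzy_vector R d.

Let suppv (t : R) (v : 'rV[R]_d) : R := sup [set dotp v a | a in fuzzy_cut x t].

Let bound : exists2 M : R, 0 < M & forall t a i, 0 < t ->
  fuzzy_cut x t a -> `|a ord0 i| <= M.
Proof.
have [M M0 HM] := ex_strict_bound_gt0 (fuzzy_supp_bounded x).
exists M => // t a i t0 xa; apply: (le_trans _ (ltW (HM a _))).
  by rewrite [leRHS]/normr/= mx_normrE; apply/bigmax_geP; right => /=; exists (ord0, i).
by apply: subset_closure => /=; exact: lt_le_trans xa.
Qed.

Let dotp_diff M t (u v a : 'rV[R]_d) e : 0 < t ->
  (forall t a i, 0 < t -> fuzzy_cut x t a -> `|a ord0 i| <= M) ->
  (forall i, `|u ord0 i - v ord0 i| <= e) -> 0 <= e ->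
  fuzzy_cut x t a ->
  dotp u a <= dotp v a + e * M *+ d.
Proof.
move=> t0 HM uv e0 xa; rewrite -lerBlDl /dotp -sumrB.
rewrite -[X in _ <= _ *+ X]card_ord -sumr_const.
apply: ler_sum => i _; rewrite -mulrBl (le_trans (ler_norm _))// normrM.
by apply: ler_pM => //; exact: HM xa.
Qed.

Let has_sup_dotp t v : 0 < t <= 1 ->
  has_sup [set dotp v a | a in fuzzy_cut x t].
Proof.
move=> t01; have [[a xa] _ _] := fuzzy_cutP x t01.
have /andP[t0 _] := t01.
split; first by exists (dotp v a), a.
have [M M0 HM] := bound.
exists (enorm v * M *+ d) => _ [b xb <-].
have := dotp_diff (u := v) (v := 0) (e := enorm v) t0 HM _ (enorm_ge0 v) xb.
rewrite [dotp 0 b]big1 ?add0r; last by move=> i _; rewrite mxE mul0r.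
by apply => i; rewrite mxE subr0 normr_coord_le_enorm.
Qed.

Let suppv_diff M t (u v : 'rV[R]_d) e : 0 < t <= 1 ->
  (forall t a i, 0 < t -> fuzzy_cut x t a -> `|a ord0 i| <= M) ->
  (forall i, `|u ord0 i - v ord0 i| <= e) -> 0 <= e ->
  suppv t u <= suppv t v + e * M *+ d.
Proof.
move=> t01 HM uv e0; have /andP[t0 _] := t01.
apply: ge_sup; first by case: (has_sup_dotp u t01).
move=> _ [a xa <-]; apply: le_trans (dotp_diff t0 HM uv e0 xa) _.
rewrite lerD2r; apply: ub_le_sup; last by exists a.
by case: (has_sup_dotp v t01).
Qed.

Let support_funE z : support_fun x z = suppv (unit_itv_val z.1) (sphere_val z.2).
Proof. by []. Qed.

Let unit_itvP (a : unit_itv R) : 0 < unit_itv_val a <= 1.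
Proof. by have := valP a; rewrite in_itv. Qed.

Let support_fun_bounded : exists M : R, forall z, `|support_fun x z| <= M.
Proof.
have [M M0 HM] := bound.
exists (1 * M *+ d) => z; rewrite support_funE.
set t := unit_itv_val _; set u := sphere_val _.
have t01 : 0 < t <= 1 by exact: unit_itvP.
have u1 i : `|u ord0 i| <= 1.
  by rewrite -(eqP (valP z.2)); exact: normr_coord_le_enorm.
have s0 : suppv t 0 = 0.
  rewrite /suppv [X in sup X](_ : _ = [set 0]) ?sup1//.
  have [[a xa] _ _] := fuzzy_cutP x t01.
  apply/seteqP; split => [_ [b xb <-]|_ ->].
    by rewrite /dotp big1// => i _; rewrite mxE mul0r.
  by exists a => //; rewrite /dotp big1// => i _; rewrite mxE mul0r.
rewrite ler_norml; apply/andP; split.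
  rewrite lerNl -subr_ge0 opprK addrC -s0.
  by apply: suppv_diff => // i; rewrite mxE sub0r normrN.
rewrite -[leRHS]add0r -s0.
by apply: suppv_diff => // i; rewrite mxE subr0.
Qed.

Lemma measurable_support_fun : measurable_fun [set: X] (support_fun x).
Proof.
have [M M0 HM] := bound.
pose L (n : nat) : R := n.+1%:R^-1.
pose g (q : 'rV[rat]_d) : 'rV[R]_d := map_mx ratr q.
pose A (c : R) (n : nat) (q : 'rV[rat]_d) : set X :=
  [set a | c < suppv (unit_itv_val a) (g q)] `*`
  [set u | forall i, `|sphere_val u ord0 i - g q ord0 i| < L n].
move=> mD; apply: (measurability _ (RGenOInfty.measurableE R)) => //.
move=> _ [_ [c ->] <-]; rewrite setTI.
have -> : support_fun x @^-1` `]c, +oo[ =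
    \bigcup_(n in [set: nat]) \bigcup_(q in [set: 'rV[rat]_d]) A (c + L n * M *+ d) n q.
  have key z n q : (forall i, `|sphere_val z.2 ord0 i - g q ord0 i| < L n) ->
      suppv (unit_itv_val z.1) (g q) <= support_fun x z + L n * M *+ d /\
      support_fun x z <= suppv (unit_itv_val z.1) (g q) + L n * M *+ d.
    move=> zq; have L0 : 0 <= L n by rewrite invr_ge0.
    split; apply: suppv_diff => // i; try exact: unit_itvP.
    - by rewrite distrC; exact: ltW.
    - exact: ltW.
  apply/seteqP; split => z /=; rewrite in_itv /= andbT; last first.
    move=> [n _ [q _ [/= cq /key[+ _]]]] => /(lt_le_trans cq).
    by rewrite ltrD2r.
  move=> cz; pose D := M *+ d *+ 2 + 1.
  have D0 : 0 < D by rewrite ltr_wpDl// !mulrn_wge0// ltW.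
  have cD : 0 < (support_fun x z - c) / D by rewrite divr_gt0// subr_gt0.
  have [n] := ltr_add_invr cD; rewrite add0r ltr_pdivlMr// -/(L n) => nD.
  have L0 : 0 < L n by rewrite invr_gt0.
  have LD : c + L n * M *+ d + L n * M *+ d < support_fun x z.
    rewrite -addrA -ltrBrDl (lt_trans _ nD)// /D mulrDr mulr1 !mulrnAr.
    by rewrite mulr2n ltrDl.
  have /choice[f fP] : forall i : 'I_d, exists q : rat,
      `|sphere_val z.2 ord0 i - ratr q| < L n.
    move=> i; set a := sphere_val z.2 ord0 i.
    have aL : a < a + L n by rewrite ltrDl.
    have [q] := rat_in_itvoo aL; rewrite in_itv /= => /andP[aq qL]; exists q.
    by rewrite distrC gtr0_norm ?subr_gt0// ltrBlDl.
  exists n => //; exists (\row_i f i) => //.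
  have zq i : `|sphere_val z.2 ord0 i - g (\row_i f i) ord0 i| < L n by rewrite !mxE.
  split => //=; have [_ sz] := key _ _ _ zq.
  by rewrite -(ltrD2r (L n * M *+ d)); exact: lt_le_trans LD sz.
apply: bigcupT_measurable => n; apply: countable_bigcupT_measurable => // q.
apply: measurableX.
- pose I := [set t : R | 0 < t <= 1 /\ c + L n * M *+ d < suppv t (g q)].
  exists I.
    apply: is_interval_measurable => t1 t2 [/andP[t10 _] _] [/andP[_ t21] c2].
    move=> t /andP[t1t tt2].
    have t01 : 0 < t <= 1 by rewrite (lt_le_trans t10)//= (le_trans tt2).
    split => //; apply: (lt_le_trans c2); apply: sup_le.
    - move=> _ [a xa <-]; exists (dotp (g q) a); split => //.
      by exists a => //; exact: le_trans xa.
    - have t201 : 0 < t2 <= 1 by rewrite t21 (lt_le_trans t10 (le_trans t1t tt2)).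
      by case: (has_sup_dotp (g q) t201).
    - exact: has_sup_dotp.
  apply/seteqP; split => a /=; first by move=> [_ []].
  by move=> ca; split => //; split => //; exact: unit_itvP.
- exists [set v : 'rV[R]_d | forall i, `|v ord0 i - g q ord0 i| < L n].
    have -> : [set v : 'rV[R]_d | forall i, `|v ord0 i - g q ord0 i| < L n] =
        \bigcap_(i in [set: 'I_d]) ((fun v : 'rV[R]_d => v ord0 i) @^-1`
          `](g q ord0 i - L n), (g q ord0 i + L n)[).
      apply/seteqP; split => v /= vq i; first by move=> _; rewrite /= in_itv/= -ltr_distl.
      by have := vq i Logic.I; rewrite /= in_itv/= -ltr_distl.
    apply: fin_bigcap_measurable => // i _; rewrite -[X in measurable X]setTI.
    by apply: measurable_coord => //; exact: measurable_itv.
  by rewrite setTI.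
Qed.

Lemma support_fun_Lfun (p : R) (p1 : (1 <= p%:E)%E) :
  support_fun x \in @Lfun _ X R mu p%:E.
Proof.
have muT : mu [set: X] = 1%E.
  have uT : unit_itv_lebesgue [set: unit_itv R] = 1%E by exact: probability_setT.
  have sT : sphere_measure R d1 setT = 1%E by exact: probability_setT.
  transitivity (unit_itv_lebesgue [set: unit_itv R] * sphere_measure R d1 setT)%E.
    by rewrite -setXTT product_measure1E.
  by rewrite uT sT mule1.
have [M HM] := support_fun_bounded.
have finT : mu [set: X] \is a fin_num by rewrite muT.
apply: (Lfun_subset p1 (leey 1) finT (leey _)).
rewrite inE; apply/andP; split; rewrite inE /=; first exact: measurable_support_fun.
rewrite /finite_norm unlock; case: ifPn => // _.
apply: (@le_lt_trans _ _ M%:E); last exact: ltry.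
by apply/ess_supP/nearW => z /=; rewrite lee_fin.
Qed.

Definition support_embedding (p : R) (p1 : (1 <= p%:E)%E) : LspaceType mu p1 :=
  Lclass p1 (support_fun_Lfun p1).

End support_function.

(* Main.v *)
(* The cuts of x + y (sup-min convolution) and l x are the Minkowski sums and
   dilates of the cuts, and the support function is additive and positively
   homogeneous under these operations, so the image is a convex cone. If
   s_x + s_y = 0 almost everywhere, then by Fubini, for almost every a, any
   v in C_a(x) and w in C_a(y) satisfy <u, v + w> <= 0 for almost every u; as
   open half-spheres have positive measure, w = - v. Both v and - v are in the
   proper cone K, hence C_a(x) = {0} for almost every a and s_x = 0 almost
   everywhere. *)
Require Import Defs.
From HB Require Import structures.
From mathcomp Require Import all_boot all_order all_algebra.
From mathcomp Require Import all_classical all_reals all_analysis.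
Set Implicit Arguments.
Unset Strict Implicit.
Unset Printing Implicit Defensive.
Import Order.TTheory GRing.Theory Num.Theory.
Import numFieldNormedType.Exports.
Local Open Scope classical_set_scope.
Local Open Scope ring_scope.

(** * Convexity and compactness preliminaries *)

(** [convex_set] ranges over scalars bundled with a proof that they lie in the unit interval; this
    form takes a plain real and its two bounds. *)
Lemma convex_setE (R : realType) (V : lmodType R) (A : set V) :
  convex_set A <-> forall (t : R) x y, 0 <= t -> t <= 1 -> A x -> A y ->
    A (t *: x + (1 - t) *: y).
Proof.
split=> [cA t x y t0 t1 Ax Ay|cA x y t /set_mem Ax /set_mem Ay].
  have t01 : Itv.spec (Itv.num_sem (R:=R)) (Itv.Real `[0%Z, 1%Z]) t.
    by rewrite /= /Itv.num_sem ger0_real//= in_itv /= t0 t1.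
  have := cA x y (Itv.mk t01); rewrite !inE => /(_ Ax Ay).
  by [].
apply/mem_set; have := cA t%:num x y _ _ Ax Ay; apply => //.
Qed.

(** A convex combination is continuous in each argument separately, so membership in [closure A]
    extends from [A] to its closure one argument at a time. *)
Lemma convex_closure (R : realType) (V : normedModType R) (A : set V) :
  convex_set A -> convex_set (closure A).
Proof.
move=> /convex_setE cA; apply/convex_setE => t x y t0 t1 clx cly.
pose f (a b : V) : V := t *: a + (1 - t) *: b.
have step (g : V -> V) (B : set V) : continuous g ->
    (forall a, B a -> closure A (g a)) -> forall a, closure B a -> closure A (g a).
  move=> cg gB a; rewrite [closure B]closureE => /(_ (g @^-1` closure A)); apply.
  by split => //; move/continuous_closedP : cg; apply; exact: closed_closure.
apply: (step (f x) A) => // [|b Ab].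
  by move=> b; apply: cvgD; [exact: cvg_cst|exact: scaler_continuous].
apply: (step (f ^~ b) A) => // [|a Aa].
  by move=> a; apply: cvgD; [exact: scaler_continuous|exact: cvg_cst].
by apply: subset_closure; exact: cA.
Qed.

(** The sets [D t] form a filter base on the compact set [B]; a cluster point lies in the closure of
    each [D t], hence in [D t]. *)
Lemma nested_compact_nonempty (R : realType) (T : topologicalType) (B : set T)
    (D : R -> set T) (a : R) : 0 < a -> compact B ->
  (forall t, 0 < t < a -> [/\ D t !=set0, closed (D t) & D t `<=` B]) ->
  (forall s t, 0 < s -> s <= t -> t < a -> D t `<=` D s) ->
  exists p, forall t, 0 < t < a -> D t p.
Proof.
move=> a0 cB DP Ddec.
have FF : ProperFilter (filter_from [set t | 0 < t < a] D).
  apply: filter_from_proper; last by move=> t /DP[].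
  apply: filter_from_filter.
    by exists (a / 2); rewrite /= divr_gt0//= ltr_pdivrMr// ltr_pMr// ltr1n.
  move=> s t /andP[s0 sa] /andP[t0 ta]; exists (Num.max s t) => /=.
    by rewrite lt_max s0/= gt_max sa.
  by rewrite subsetI; split; apply: Ddec => //;
    rewrite ?le_max ?lexx ?orbT// gt_max sa.
have [|p [_]] := cB (filter_from [set t | 0 < t < a] D).
  exists (a / 2); first by rewrite /= divr_gt0//= ltr_pdivrMr// ltr_pMr// ltr1n.
  by have [] := DP (a / 2) _; rewrite ?divr_gt0//= ltr_pdivrMr// ltr_pMr// ltr1n.
rewrite clusterE => cp; exists p => t ta.
have [_ /closure_id -> _] := DP t ta.
by apply: cp; exists t.
Qed.

(** * Fuzzy vectors built from their cuts: sums and dilates *)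

Section fuzzy_vectors.
Variables (R : realType) (d : nat).
Implicit Types (x y z : fuzzy_vector R d) (a s t : R).

(** Representation theorem: the membership degree of [v] is the largest level whose set contains
    [v]. The compact set [B] also confines the support, which the cuts alone do not: a cone [K] need
    not be closed, so having every positive cut in [K] would not place the support in [K]. *)
Lemma fuzzy_of_cuts (C : R -> set 'rV[R]_d) (B : set 'rV[R]_d) :
  compact B ->
  (forall a, 0 < a <= 1 ->
    [/\ C a !=set0, compact (C a), convex_set (C a) & C a `<=` B]) ->
  (forall s t, 0 < s -> s <= t -> t <= 1 -> C t `<=` C s) ->
  (forall a v, 0 < a <= 1 -> (forall t, 0 < t < a -> C t v) -> C a v) ->
  exists z, (forall a, 0 < a <= 1 -> fuzzy_cut z a = C a) /\
            fuzzy_supp z `<=` B.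
Proof.
move=> cB CP Cdec Clc.
(* The level 0 is put in by hand so that the set is never empty; a point outside every [C t] gets
   degree 0. *)
pose S v : set R := [set t | t = 0 \/ (0 < t <= 1 /\ C t v)].
pose xi v := sup (S v).
have supS v : has_sup (S v).
  split; first by exists 0; left.
  by exists 1 => t [->|[/andP[_ ?] _]].
have xi_le v t : S v t -> t <= xi v by apply: ub_le_sup; case: (supS v).
have xi01 v : 0 <= xi v <= 1.
  rewrite xi_le/=; last by left.
  apply: ge_sup; first by case: (supS v).
  by move=> t [->|[/andP[_ ?] _]].
have below t v : 0 < t -> t < xi v -> C t v.
  move=> t0 txi; have txi0 : 0 < xi v - t by rewrite subr_gt0.
  have [s Ss] := sup_adherent txi0 (supS v).
  rewrite subKr => ts; case: Ss => [s0|[/andP[s0 s1] Cs]].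
    by move: (lt_trans t0 ts); rewrite s0 ltxx.
  exact: Cdec (ltW ts) s1 _ Cs.
(* The definition of [xi] as a supremum controls only the levels strictly below [xi v]; the assumed
   left continuity [Clc] covers the level [a = xi v]. *)
have cutE a : 0 < a <= 1 -> fuzzy_cut xi a = C a.
  move=> a01; apply/seteqP; split => v /=; last by move=> Cav; apply: xi_le; right.
  by move=> axi; apply: Clc => // t /andP[t0 ta]; apply: below => //; exact: lt_le_trans axi.
have suppB : fuzzy_supp xi `<=` B.
  rewrite /fuzzy_supp closureE; apply: smallest_sub.
    by apply: compact_closed => //; exact: norm_hausdorff.
  move=> v /= v0; have [_ v1] := andP (xi01 v).
  have v01 : 0 < xi v <= 1 by rewrite v0.
  by have [_ _ _] := CP _ v01; apply; rewrite -cutE// /fuzzy_cut /=.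
have ne1 : fuzzy_cut xi 1 !=set0.
  have h : 0 < (1 : R) <= 1 by rewrite ltr01 lexx.
  by rewrite cutE//; have [] := CP _ h.
(* Two points of positive degree share the cut at the smaller of their degrees, and that cut is
   convex. *)
have cxi : convex_set [set v | 0 < xi v].
  apply/convex_setE => t u v t0 t1 /= u0 v0.
  pose m := Num.min (xi u) (xi v).
  have m01 : 0 < m <= 1.
    by rewrite lt_min u0 v0/= ge_min; have /andP[_ ->] := xi01 u.
  have [_ _ /convex_setE cC _] := CP _ m01.
  have : fuzzy_cut xi m (t *: u + (1 - t) *: v).
    by rewrite cutE//; apply: cC => //; rewrite -cutE// /fuzzy_cut /= ge_min lexx ?orbT.
  by apply: lt_le_trans; case/andP: m01.
have csupp : compact (fuzzy_supp xi).
  by apply: (subclosed_compact _ cB) => //; exact: closed_closure.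
unshelve eexists (@FuzzyVector R d xi xi01 _ _ _).
- exact: compact_bounded.
- by move=> a a01; rewrite cutE//; have [] := CP _ a01.
- split => //; last exact: convex_closure.
  have [v v1] := ne1; exists v; apply: subset_closure => /=.
  by apply: lt_le_trans v1.
- by [].
Qed.

Lemma fuzzy_cut_supp x a : 0 < a -> fuzzy_cut x a `<=` fuzzy_supp x.
Proof. by move=> a0 v av; apply: subset_closure => /=; exact: lt_le_trans av. Qed.

Lemma fuzzy_cut_left_continuous x a v : 0 < a ->
  (forall t, 0 < t < a -> fuzzy_cut x t v) -> fuzzy_cut x a v.
Proof.
move=> a0 xv; rewrite /fuzzy_cut /= leNgt; apply/negP => va.
have /andP[v0 _] := fuzzy_char_itv x v.
have : 0 < (x v + a) / 2 < a by rewrite divr_gt0 ?ltr_wpDl//= midf_lt.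
move=> /xv; rewrite /fuzzy_cut /= leNgt => /negP; apply.
by rewrite midf_lt.
Qed.

(** The delicate condition is left continuity: for each [t < a] the point [v] splits into summands
    that may vary with [t], and compactness yields one splitting valid for all these [t]. *)
Lemma fuzzy_add x y : exists z,
  (forall a, 0 < a <= 1 -> fuzzy_cut z a =
    [set u + v | u in fuzzy_cut x a & v in fuzzy_cut y a]) /\
  fuzzy_supp z `<=` [set u + v | u in fuzzy_supp x & v in fuzzy_supp y].
Proof.
have cD (A B : set 'rV[R]_d) : compact A -> compact B ->
    compact [set u + v | u in A & v in B].
  move=> cA cB; rewrite image2E.
  rewrite (_ : uncurry _ = fun w : 'rV[R]_d * 'rV[R]_d => w.1 + w.2); last by apply/funext => -[].
  apply: continuous_compact.
    by apply: continuous_subspaceT; exact: add_continuous.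
  exact: compact_setX.
have [_ csx _] := fuzzy_suppP x; have [_ csy _] := fuzzy_suppP y.
have hd : hausdorff_space 'rV[R]_d by exact: norm_hausdorff.
apply: fuzzy_of_cuts; first exact: cD.
- move=> a a01; have /andP[a0 _] := a01.
  have [[u xu] cx /convex_setE vx] := fuzzy_cutP x a01.
  have [[v yv] cy /convex_setE vy] := fuzzy_cutP y a01.
  split; [by exists (u + v), u => //; exists v|exact: cD| |].
    apply/convex_setE => t _ _ t0 t1 [u1 xu1 [v1 yv1 <-]] [u2 xu2 [v2 yv2 <-]].
    exists (t *: u1 + (1 - t) *: u2); first exact: vx.
    exists (t *: v1 + (1 - t) *: v2); first exact: vy.
    by rewrite !scalerDr addrACA.
  by apply: image2_subset; exact: fuzzy_cut_supp.
- move=> s t s0 st t1; apply: image2_subset => v; exact: le_trans.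
- move=> a v /andP[a0 a1] Cv.
  (* The possible first summands of [v] at level [t]. *)
  pose D t := fuzzy_cut x t `&` (fun u => v - u) @^-1` fuzzy_cut y t.
  have [||p Dp] := @nested_compact_nonempty R _ (fuzzy_supp x) D a a0 csx.
  + move=> t /[dup] ta /andP[t0 lta].
    have t01 : 0 < t <= 1 by rewrite t0 (le_trans (ltW lta)).
    have [_ /(compact_closed hd) clx _] := fuzzy_cutP x t01.
    have [_ /(compact_closed hd) cly _] := fuzzy_cutP y t01.
    split; [|apply: closedI => //|by move=> u [+ _]; exact: fuzzy_cut_supp].
      by have [u xu [w yw uw]] := Cv t ta; exists u; split => //=; rewrite -uw addrC addKr.
    have cB : continuous (fun u : 'rV[R]_d => v - u).
      by move=> u; apply: (@continuousB _ 'rV[R]_d _ (fun=> v) id u); [exact: cst_continuous|exact: cvg_id].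
    by move/continuous_closedP : cB; apply.
  + by move=> s t s0 st ta u [xu yu]; split; [exact: le_trans xu|exact: le_trans yu].
  exists p; first by apply: fuzzy_cut_left_continuous => // t /Dp[].
  exists (v - p); last by rewrite addrC subrK.
  by apply: fuzzy_cut_left_continuous => // t /Dp[].
Qed.

Lemma fuzzy_scale x (l : R) : 0 < l -> exists z,
  (forall a, 0 < a <= 1 -> fuzzy_cut z a = [set l *: v | v in fuzzy_cut x a]) /\
  fuzzy_supp z `<=` [set l *: v | v in fuzzy_supp x].
Proof.
move=> l0.
have cZ (A : set 'rV[R]_d) : compact A -> compact [set l *: v | v in A].
  by apply: continuous_compact; apply: continuous_subspaceT; exact: scaler_continuous.
have [_ csx _] := fuzzy_suppP x.
apply: fuzzy_of_cuts; first exact: cZ.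
- move=> a a01; have /andP[a0 _] := a01.
  have [[u xu] cx /convex_setE vx] := fuzzy_cutP x a01.
  split; [by exists (l *: u), u|exact: cZ| |].
    apply/convex_setE => t _ _ t0 t1 [u1 xu1 <-] [u2 xu2 <-].
    exists (t *: u1 + (1 - t) *: u2); first exact: vx.
    by rewrite scalerDr !scalerA !(mulrC l).
  by apply: image_subset; exact: fuzzy_cut_supp.
- by move=> s t s0 st t1; apply: image_subset => v; exact: le_trans.
(* No compactness argument here: the preimage of [v] is the same at all levels. *)
- move=> a v /andP[a0 a1] Cv; exists (l^-1 *: v).
    apply: fuzzy_cut_left_continuous => // t /Cv[u xu <-].
    by rewrite scalerA mulVf ?gt_eqF// scale1r.
  by rewrite scalerA mulfV ?gt_eqF// scale1r.
Qed.

End fuzzy_vectors.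

(** * Support functions of sums and dilates *)

Section support.
Variables (R : realType) (d : nat).
Implicit Types (x y z : fuzzy_vector R d) (a : R) (u v w : 'rV[R]_d).

Lemma dotpDr u v w : dotp u (v + w) = dotp u v + dotp u w.
Proof. by rewrite /dotp -big_split; apply: eq_bigr => i _; rewrite mxE mulrDr. Qed.

Lemma dotpZl (l : R) u v : dotp (l *: u) v = l * dotp u v.
Proof. by rewrite /dotp mulr_sumr; apply: eq_bigr => i _; rewrite mxE mulrA. Qed.

Lemma dotpZr (l : R) u v : dotp u (l *: v) = l * dotp u v.
Proof. by rewrite /dotp mulr_sumr; apply: eq_bigr => i _; rewrite mxE mulrCA. Qed.

Lemma dotp0r u : dotp u 0 = 0.
Proof. by rewrite /dotp big1// => i _; rewrite mxE mulr0. Qed.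

Lemma continuous_dotp u : continuous (dotp u).
Proof.
apply: continuous_big => [|i _ v]; first exact: add_continuous.
by apply: continuousM; [exact: cst_continuous|exact: coord_continuous].
Qed.

(** A continuous image of a compact cut is bounded; this ensures that the [sup] below is a true
    supremum and not its default value. *)
Lemma has_sup_dotp_cut x a u : 0 < a <= 1 ->
  has_sup [set dotp u v | v in fuzzy_cut x a].
Proof.
move=> a01; have [[v xv] cx _] := fuzzy_cutP x a01.
split; first by exists (dotp u v), v.
have : compact [set dotp u v | v in fuzzy_cut x a].
  apply: continuous_compact => //; apply: continuous_subspaceT.
  exact: continuous_dotp.
move=> /(@compact_bounded _ R^o)/ex_strict_bound_gt0[M _ HM].
by exists M => r /HM /ltW; exact: le_trans (ler_norm _).
Qed.

Lemma sup_dotpD a u x y z : 0 < a <= 1 ->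
  fuzzy_cut z a = [set v + w | v in fuzzy_cut x a & w in fuzzy_cut y a] ->
  sup [set dotp u v | v in fuzzy_cut z a] =
  sup [set dotp u v | v in fuzzy_cut x a] + sup [set dotp u v | v in fuzzy_cut y a].
Proof.
move=> a01 ->; rewrite -sup_sumE; try exact: has_sup_dotp_cut.
congr sup; apply/seteqP; split => [_ [_ [v xv [w yw <-]] <-]|].
  exists (dotp u v); first by exists v.
  by exists (dotp u w); [exists w|rewrite dotpDr].
move=> _ [_ [v xv <-] [_ [w yw <-] <-]].
by exists (v + w); [exists v => //; exists w|rewrite dotpDr].
Qed.

Lemma sup_dotpZ a u (l : R) x z : 0 < a <= 1 -> 0 < l ->
  fuzzy_cut z a = [set l *: v | v in fuzzy_cut x a] ->
  sup [set dotp u v | v in fuzzy_cut z a] =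
  l * sup [set dotp u v | v in fuzzy_cut x a].
Proof.
move=> a01 l0 zx.
have [z0 zub] := has_sup_dotp_cut z u a01.
have [x0 xub] := has_sup_dotp_cut x u a01.
apply/eqP; rewrite eq_le; apply/andP; split.
  apply: ge_sup => // _ [w + <-]; rewrite zx => -[v xv <-].
  by rewrite dotpZr ler_pM2l//; apply: ub_le_sup => //; exists v.
rewrite -ler_pdivlMl//; apply: ge_sup => // _ [v xv <-].
rewrite ler_pdivlMl// -dotpZr; apply: ub_le_sup => //.
by exists (l *: v) => //; rewrite zx; exists v.
Qed.

End support.

(** * Open half-spheres have positive measure *)

(** Unlike in [rV_lebesgue_box], the bounds depend on the coordinate, so that the box can be placed
    in any orthant. The induction follows the recursive definition of [rV_lebesgue]: a box is an
    interval times a box of one dimension less. *)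
Lemma rV_lebesgue_orthotope_gt0 (R : realType) n (a b : 'I_n -> R) :
  (forall i, a i < b i) ->
  measurable [set v : 'rV[R]_n | forall i, a i < v ord0 i < b i] /\
  (0 < rV_lebesgue R n [set v | forall i, a i < v ord0 i < b i]%R)%E.
Proof.
have mbox k (f g : 'I_k -> R) :
    measurable [set v : 'rV[R]_k | forall i, f i < v ord0 i < g i].
  have -> : [set v : 'rV[R]_k | forall i, f i < v ord0 i < g i] =
      \bigcap_(i in [set: 'I_k]) ((fun v : 'rV[R]_k => v ord0 i) @^-1` `]f i, g i[).
    apply/seteqP; split => v /= vfg i; first by move=> _; rewrite /= in_itv/=.
    by have := vfg i Logic.I; rewrite /= in_itv/=.
  apply: fin_bigcap_measurable => // i _; rewrite -[X in measurable X]setTI.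
  by apply: measurable_coord => //; exact: measurable_itv.
elim: n a b => [|n IHn] a b ab; split => //.
  rewrite /= /dirac indicE mem_set ?lte01// => -[].
  by [].
pose a' i := a (rshift 1 i); pose b' i := b (rshift 1 i).
pose i0 : 'I_(1 + n) := lshift n ord0.
pose B := [set v : 'rV[R]_n | forall i, a' i < v ord0 i < b' i].
have [_ B0] := IHn a' b' (fun i => ab _).
rewrite [ltRHS](_ : _ = (@lebesgue_measure R `]a i0, b i0[ * rV_lebesgue R n B)%E).
  rewrite mule_gt0// lebesgue_measure_itv /= lte_fin ab -EFinB lte_fin subr_gt0.
  exact: ab.
rewrite -product_measure1E//; last exact: mbox.
rewrite /= /rV_step /pushforward; congr (_ _).
apply/seteqP; split => -[t v] /=.
  move=> vab; split.
    by have := vab i0; rewrite rV_cons_head /= in_itv.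
  by move=> i; have := vab (rshift 1 i); rewrite rV_cons_tail.
rewrite in_itv /= => -[tab vab] i.
case: (splitP (i : 'I_(1 + n))) => j ij.
  have -> : i = i0 by apply: val_inj; rewrite /= ij (ord1 j).
  by rewrite rV_cons_head.
have -> : i = rshift 1 j by apply: val_inj.
by rewrite rV_cons_tail; exact: vab.
Qed.

Section half_sphere.
Variables (R : realType) (d : nat) (d1 : (1 < d)%N).
Local Notation S := (sphere R d1).

(** The total content is positive and finite, so normalizing multiplies by a nonzero constant. *)
Lemma sphere_measure_eq0 (A : set S) :
  sphere_measure R d1 A = 0%E -> sphere_content A = 0%E.
Proof.
have /andP[c0 coo] := sphere_content_gt0_lty R d1.
rewrite /sphere_measure /= /mnormalize gt_eqF//= lt_eqF//= => /eqP.
rewrite mule_eq0 => /orP[/eqP//|]; rewrite eqe invr_eq0 => /eqP f0.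
by move: c0; rewrite -(@fineK _ (sphere_content _)) ?f0 ?ltxx// ge0_fin_numE// ltW.
Qed.

(** If [w] is nonzero, the null set [N] contains the open half-sphere around [w], and the cone over
    [N] contains a box of positive Lebesgue measure. *)
Lemma ae_dotp_le0 (w : 'rV[R]_d) :
  (\forall u \ae sphere_measure R d1, dotp (sphere_val u) w <= 0) -> w = 0.
Proof.
move=> [N [mN /sphere_measure_eq0 N0 subN]]; apply/eqP; apply/contraT => w0.
have d0 : (0 : R) < d%:R by rewrite ltr0n (ltn_trans _ d1).
(* a cube with vertex 0 in a closed orthant containing w: it is included in
     the cone over the half-sphere {u | <u, w> > 0} *)
pose a i : R := if 0 <= w ord0 i then 0 else - d%:R^-1.
pose b i : R := if 0 <= w ord0 i then d%:R^-1 else 0.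
have ab i : a i < b i by rewrite /a /b; case: ifP => _; rewrite ?oppr_lt0 invr_gt0.
have [mB B0] := rV_lebesgue_orthotope_gt0 ab.
suff : (0 < @sphere_content R d d1 N)%E by rewrite N0 ltxx.
apply: lt_le_trans B0 _; apply: le_measure; rewrite ?inE//.
  exact: measurable_sphere_cone.
move=> v vab.
have vn i : `|v ord0 i| <= d%:R^-1.
  have := vab i; rewrite /a /b; case: ifP => _ /andP[v1 v2].
    by rewrite gtr0_norm// ltW.
  by rewrite ltr0_norm// lerNl ltW.
have vw0 i : 0 <= v ord0 i * w ord0 i.
  have := vab i; rewrite /a /b; case: ifP => [w1|/negbT]; last rewrite -ltNge => w1.
    by move=> /andP[v1 _]; rewrite mulr_ge0// ltW.
  by move=> /andP[_ v2]; rewrite mulr_le0// ltW.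
have v0 i : v ord0 i != 0.
  have := vab i; rewrite /a /b; case: ifP => _ /andP[v1 v2].
    by rewrite gt_eqF.
  by rewrite lt_eqF.
have x0 : 0 < enorm v.
  have i0 : 'I_d by exact: Ordinal (ltn_trans (ltn0Sn 0) d1).
  by apply: lt_le_trans (normr_coord_le_enorm v i0); rewrite normr_gt0.
have vx : enorm ((enorm v)^-1 *: v) == 1.
  by rewrite enormZ ?invr_ge0 ?enorm_ge0// mulVf// gt_eqF.
split.
  (* The side 1/d puts the cube in the unit ball: each squared coordinate is at most 1/d, and there
     are d of them. *)
  rewrite x0 /= -sqrtr1 ler_wsqrtr// (@le_trans _ _ (\sum_(i < d) d%:R^-1))//.
    apply: ler_sum => i _; rewrite -[leRHS]mulr1 (le_trans (ler_norm _))// normrM.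
    apply: ler_pM => //; rewrite (le_trans (vn i))// invf_le1// ler1n.
    exact: ltn_trans d1.
  by rewrite sumr_const card_ord -(mulr_natr d%:R^-1 d) mulVf// gt_eqF.
exists (exist _ ((enorm v)^-1 *: v) vx : S); last first.
  by rewrite /sphere_val /= scalerA mulfV ?scale1r// gt_eqF.
apply: subN => /=; apply/negP; rewrite -ltNge /sphere_val /= dotpZl.
rewrite mulr_gt0 ?invr_gt0//.
(* All terms of the inner product are nonnegative; one where [w] has a nonzero coordinate is
   positive, since the open cube avoids the coordinate hyperplanes. *)
have /rV0Pn[i wi] := w0.
rewrite /dotp (bigD1 i)//= ltr_wpDr ?sumr_ge0// lt_def vw0 andbT.
by rewrite mulf_neq0.
Qed.

End half_sphere.

(** * Null sets of product measures *)

(** The measure of a null set [A] is the integral of the measures of its sections; a nonnegative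
    function with zero integral vanishes almost everywhere. *)
Lemma product_ae_xsection d1 d2 (T1 : measurableType d1) (T2 : measurableType d2)
    (R : realType) (m1 : {sigma_finite_measure set T1 -> \bar R})
    (m2 : {sigma_finite_measure set T2 -> \bar R}) (P : T1 * T2 -> Prop) :
  (\forall z \ae (m1 \x m2)%E, P z) ->
  \forall s \ae m1, \forall t \ae m2, P (s, t).
Proof.
move=> [A [mA A0 PA]].
have mf := measurable_fun_xsection m2 mA.
have /(ae_eq_integral_abs m1 measurableT mf) :
    (\int[m1]_s `|(m2 \o xsection A) s| = 0)%E.
  by rewrite -[RHS]A0; apply: eq_integral => s _; rewrite /= gee0_abs.
apply: filterS => s /(_ Logic.I) /= As0.
exists (xsection A s); split => //; first exact: measurable_xsection.
by move=> t /= nP; rewrite /xsection /= inE; exact: PA.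
Qed.

(** Carries a property of almost every level back to the product: the exceptional set lies in a
    cylinder over a null set. *)
Lemma product_ae_fst d1 d2 (T1 : measurableType d1) (T2 : measurableType d2)
    (R : realType) (m1 : {sigma_finite_measure set T1 -> \bar R})
    (m2 : {sigma_finite_measure set T2 -> \bar R}) (P : T1 -> Prop) :
  (\forall s \ae m1, P s) -> \forall z \ae (m1 \x m2)%E, P z.1.
Proof.
move=> [A [mA A0 PA]]; exists (A `*` setT); split.
- exact: measurableX.
- transitivity (m1 A * m2 setT)%E; first exact: product_measure1E.
  by rewrite A0 mul0e.
- by move=> z /= nP; split => //; exact: PA.
Qed.

(** * Linearity and properness of the embedding *)

Section support_embedding.
Variables (R : realType) (d : nat) (d1 : (1 < d)%N) (p : R) (p1 : (1 <= p%:E)%E).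
Implicit Types x y z : fuzzy_vector R d.
Local Notation j := (fun x : fuzzy_vector R d => support_embedding d1 x p1).
Local Notation mu := (unit_itv_lebesgue (R := R) \x sphere_measure R d1)%E.

Lemma unit_itv_val_itv (s : unit_itv R) : 0 < unit_itv_val s <= 1.
Proof. by have := valP s; rewrite in_itv. Qed.

Lemma support_embeddingE x :
  \forall q \ae mu, (j x : _ -> R) q = support_fun x q.
Proof. by apply: (filterS _ (LclassE p1 (support_fun_Lfun d1 x p1))) => q; apply. Qed.

Lemma support_embeddingD x y z :
  (forall a, 0 < a <= 1 -> fuzzy_cut z a =
    [set u + v | u in fuzzy_cut x a & v in fuzzy_cut y a]) ->
  j z = j x + j y.
Proof.
move=> zxy; apply/Lspace_eqP.
apply: (filterS3 _ _ (LspaceDE (j x) (j y)) (support_embeddingE z)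
  (filterI (support_embeddingE x) (support_embeddingE y))).
move=> [s u] /(_ Logic.I) jD jz [jx jy] _; rewrite jD jz jx jy.
by apply: sup_dotpD; [|apply: zxy]; exact: unit_itv_val_itv.
Qed.

Lemma support_embeddingZ x z (l : R) : 0 < l ->
  (forall a, 0 < a <= 1 -> fuzzy_cut z a = [set l *: v | v in fuzzy_cut x a]) ->
  j z = l *: j x.
Proof.
move=> l0 zx; apply/Lspace_eqP.
apply: (filterS3 _ _ (LspaceZE l (j x)) (support_embeddingE z) (support_embeddingE x)).
move=> [s u] /(_ Logic.I) jZ jz jx _; rewrite jZ jz jx.
by apply: sup_dotpZ => //; [|apply: zx]; exact: unit_itv_val_itv.
Qed.

(** Fixing the level first keeps the two cuts fixed while the direction [u] varies, as [ae_dotp_le0]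
    requires. *)
Lemma ae_support_fun_oppr x y : j y = - j x ->
  \forall s \ae (@unit_itv_lebesgue R), \forall u \ae sphere_measure R d1,
    support_fun x (s, u) + support_fun y (s, u) = 0.
Proof.
move=> yx.
apply: (@product_ae_xsection _ _ _ _ R (@unit_itv_lebesgue R) (sphere_measure R d1)
  (fun q => support_fun x q + support_fun y q = 0)).
have xy0 : j x + j y = 0 by rewrite yx subrr.
have := LspaceDE (j x) (j y); rewrite xy0 => D.
apply: (filterS3 _ _ D (Lspace0E mu p1)
  (filterI (support_embeddingE x) (support_embeddingE y))).
by move=> q /(_ Logic.I) Dq /(_ Logic.I) q0 [<- <-]; rewrite -Dq q0.
Qed.

Lemma support_embedding_proper (K : set 'rV[R]_d) x y :
  (forall v, K v -> K (- v) -> v = 0) ->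
  fuzzy_supp x `<=` K -> fuzzy_supp y `<=` K ->
  j y = - j x -> j x = 0.
Proof.
move=> Kproper xK yK /ae_support_fun_oppr sxy.
(* Once the cut of [x] at level [s] is known to be the origin alone, every direction [u] is covered,
   not just almost every one. *)
suff x0 : \forall s \ae (@unit_itv_lebesgue R), forall u : sphere R d1,
    support_fun x (s, u) = 0.
  apply/Lspace_eqP; apply: (filterS3 _ _ (Lspace0E mu p1) (support_embeddingE x)
    (product_ae_fst (sphere_measure R d1) x0)).
  by move=> [s u] /(_ Logic.I) -> -> /(_ u).
apply: filterS sxy => s sxy u.
have s01 := unit_itv_val_itv s; have /andP[s0 _] := s01.
have x0 v w : fuzzy_cut x (unit_itv_val s) v -> fuzzy_cut y (unit_itv_val s) w -> v = 0.
  move=> xv yw; have vw : v + w = 0.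
    apply: (@ae_dotp_le0 _ _ d1); apply: filterS sxy => u' <-.
    (* The inner products of [u'] with [v] and [w] are bounded by the two support functions, whose
       sum is 0 for almost every [u']. *)
    have [_ ubx] := has_sup_dotp_cut x (sphere_val u') s01.
    have [_ uby] := has_sup_dotp_cut y (sphere_val u') s01.
    by rewrite dotpDr lerD//; apply: ub_le_sup => //; [exists v|exists w].
  apply: Kproper; first exact/xK/(fuzzy_cut_supp s0).
  (* Here [w] is rewritten as [- v], so that the support of [y] provides [K (- v)]. *)
  by rewrite -(addKr v w) vw addr0 in yw; exact/yK/(fuzzy_cut_supp s0).
have [[v xv] _ _] := fuzzy_cutP x s01; have [[w yw] _ _] := fuzzy_cutP y s01.
rewrite /support_fun /= (_ : [set _ | _ in _] = [set 0]) ?sup1//.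
apply/seteqP; split => [_ [v' xv' <-]|_ ->].
  by rewrite (x0 _ _ xv' yw) /= dotp0r.
by exists v => //; rewrite (x0 _ _ xv yw) dotp0r.
Qed.

End support_embedding.

Theorem lemma4p3 (R : realType) (d : nat) (d1 : (1 < d)%N)
    (p : R) (p1 : (1 <= p%:E)%E)
    (K : set 'rV[R]_d) (K_cone : proper_convex_cone K) :
  let j := fun x : fuzzy_vector R d => support_embedding d1 x p1 in
  let calH := range j in
  let calK := j @` [set x : fuzzy_vector R d | fuzzy_supp x `<=` K] in
  calK `<=` calH /\ proper_convex_cone calK.
Proof.
move=> j calH calK; have [[KD KZ] Kproper] := K_cone.
split; first by move=> _ [x _ <-]; exists x.
split; first split.
- move=> _ _ [x xK <-] [y yK <-]; have [z [zxy zsupp]] := fuzzy_add x y.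
  exists z; last exact: support_embeddingD.
  (* The supports, not only the cuts, decompose, so closure of [K] under addition applies
     directly. *)
  by move=> w /zsupp[u xu [v yv <-]]; apply: KD; [exact: xK|exact: yK].
- move=> l _ l0 [x xK <-]; have [z [zx zsupp]] := fuzzy_scale x l0.
  exists z; last exact: support_embeddingZ.
  by move=> w /zsupp[u xu <-]; apply: KZ => //; exact: xK.
- move=> _ [x xK <-] [y yK yx].
  exact: (support_embedding_proper Kproper xK yK yx).
Qed.
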